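(* Let $n,d\in\mathbb{N}$, $\lambda\ge1$ and $\beta\in(0,1]$. If $\mathsf{M}\colon[0,1]\times(\mathcal{S}_d)^n\to\mathcal{S}_d$ is a $(\lambda,\beta)$-estimator of top singular vector and $\mathsf{M}(\gamma,\cdot)$ is $\left(1,\frac{\beta}{4n}\right)$-differentially private for every $\gamma\in[0,1]$, then $$n\ge\Omega\!\left(\frac{\sqrt d/\lambda}{\log^{1.5}\!\left(\frac{d}{\beta\lambda}\right)}\right).$$
   Context: $\mathcal{S}_d=\{v\in\mathbb{R}^d:\|v\|_2=1\}$. An input $(x_1,\dots,x_n)\in(\mathcal{S}_d)^n$ is identified with the $n\times d$ matrix $X$ whose rows are the $x_i$; $\sigma_1(X)\ge\sigma_2(X)\ge\dots$ are its singular values and its top right singular vector $v\in\mathcal{S}_d$ maximizes $\|Xv\|_2$. $\mathsf{M}$ is a $(\lambda,\beta)$-estimator of top singular vector if for every $X\in(\mathcal{S}_d)^n$ and every $\gamma\in[0,1]$ with $\sigma_2(X)\le\gamma\sigma_1(X)$, it outputs $y\in\mathcal{S}_d$ with $\Pr_{y\sim\mathsf{M}(\gamma,X)}[\|Xy\|_2^2\ge\|Xv\|_2^2-\lambda\gamma n]\ge\beta$. A mechanism is $(\varepsilon,\delta)$-differentially private if for every two datasets differing in exactly one row and every output set $T$, $\Pr[\mathsf{M}(X)\in T]\le e^{\varepsilon}\Pr[\mathsf{M}(X')\in T]+\delta$. $\Omega(\cdot)$ hides a positive absolute constant.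
   Formalization: The formal theorem assumes n ≥ 1 and d/(βλ) ≥ 2; without the latter the bound is undefined (d/(βλ) ≤ 1) or false near 1 (d = λ = n = 1, a constant M, β → 1). *)

(* Defs.v *)
From HB Require Import structures.
From mathcomp Require Import all_boot all_order all_algebra.
From mathcomp Require Import all_classical all_reals all_analysis.
From mathcomp Require Import Rstruct Rstruct_topology.
From Stdlib Require Import Rdefinitions.

Set Implicit Arguments.
Unset Strict Implicit.
Unset Printing Implicit Defensive.

Import Order.TTheory GRing.Theory Num.Theory.
Local Open Scope ring_scope.
Local Open Scope classical_set_scope.

Definition vec (d : nat) := 'rV[R]_d.

Definition sqnorm (d : nat) (v : 'rV[R]_d) : R := \sum_(j < d) (v ord0 j) ^+ 2.

Definition sphere (d : nat) : set ('rV[R]_d) := [set v | sqnorm v = 1].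
Arguments sphere d : clear implicits.

Definition sqnormXy (n d : nat) (X : 'M[R]_(n, d)) (y : 'rV[R]_d) : R :=
  \sum_(i < n) (\sum_(j < d) X i j * y ord0 j) ^+ 2.

Definition dataset (n d : nat) (X : 'M[R]_(n, d)) : Prop :=
  forall i : 'I_n, sphere d (row i X).

Definition top_right_sv (n d : nat) (X : 'M[R]_(n, d)) (v : 'rV[R]_d) : Prop :=
  sphere d v /\ forall u, sphere d u -> sqnormXy X u <= sqnormXy X v.

(* Singular values: s is the nonincreasing list of eigenvalues (with
   multiplicity) of X^T X, i.e. the squared singular values; we then set
   sigma_k(X) = sqrt (s`_(k-1)) (with value 0 beyond the list). *)
Definition sq_singular_values (n d : nat) (X : 'M[R]_(n, d)) (s : seq R) : Prop :=
  [/\ size s = d, sorted (fun a b => b <= a) s &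
      char_poly (X^T *m X) = \prod_(a <- s) ('X - a%:P)].

Definition singular_value (n d : nat) (X : 'M[R]_(n, d)) (k : nat) : R :=
  Num.sqrt (nth 0 (xget [::] (sq_singular_values X)) k.-1).

Definition vecB (d : nat) := g_sigma_algebraType (@open ('rV[R]_d)).

Definition mechanism (n d : nat) :=
  R -> 'M[R]_(n, d) -> probability (vecB d) R.

Definition neighbors (n d : nat) (X Y : 'M[R]_(n, d)) : Prop :=
  exists (i : 'I_n), (row i X != row i Y) /\
    forall k : 'I_n, k <> i -> row k X = row k Y.

Definition outputs_on_sphere (n d : nat) (M : mechanism n d) : Prop :=
  forall (g : R) (X : 'M[R]_(n, d)), 0 <= g <= 1 -> dataset X ->
    M g X (sphere d : set (vecB d)) = 1%E.

Definition top_sv_estimator (n d : nat) (lam beta : R) (M : mechanism n d) : Prop :=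
  forall (X : 'M[R]_(n, d)) (g : R) (v : 'rV[R]_d),
    dataset X -> 0 <= g <= 1 ->
    singular_value X 2 <= g * singular_value X 1 ->
    top_right_sv X v ->
    (beta%:E <= M g X ([set y | (sqnormXy X v - lam * g * n%:R <= sqnormXy X y)%R]
                        : set (vecB d)))%E.

Definition diff_private (n d : nat) (eps delta : R) (Mg : 'M[R]_(n, d) -> probability (vecB d) R) : Prop :=
  forall (X Y : 'M[R]_(n, d)), dataset X -> dataset Y -> neighbors X Y ->
    forall T : set (vecB d), measurable T ->
      (Mg X T <= (expR eps)%:E * Mg Y T + delta%:E)%E.
Arguments diff_private n d eps%_ring_scope delta%_ring_scope Mg.

(* Main.v *)
Require Import Defs.
From Stdlib Require Import Rdefinitions.
From mathcomp Require Import all_boot all_order all_algebra.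
From mathcomp Require Import Rstruct Rstruct_topology.
From mathcomp Require Import all_classical all_reals all_analysis.
From mathcomp Require Import measurable_realfun.
From mathcomp Require Import ring lra.

Set Implicit Arguments.
Unset Strict Implicit.
Unset Printing Implicit Defensive.

Import Order.TTheory GRing.Theory Num.Theory.
Import numFieldNormedType.Exports.
Local Open Scope ring_scope.

(** A fingerprinting argument. The dataset has entries [+-1/sqrt d]; its
    columns are independent and each consists of [n] draws from a Polya urn
    with initial masses [a, a], where [a] is of order [1/lam^2]. Two rows
    differ on a fraction of about [a] of the columns, so with probability at
    least [1/2] the matrix is close enough to rank one for [gamma = 1/(4 lam)]
    to be admissible, and an accurate output correlates with the sum of the
    rows.

    For the Polya urn the conditional mean of [x_i] given the other rows is
    [(S - x_i) / (n - 1 + 2a)], with [S] the sum of the rows; hence the scores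
    [<y, (n + 2a) x_i - S>] add up to exactly [2a <y, S>]. An accurate output
    therefore gives a large score to some row [i]. By privacy this remains
    likely when row [i] is replaced by a constant row; but then the output is
    independent of [x_i], the score is a sum of independent centred terms, and
    a large value has probability [exp(- Omega(a d / n^2))]. Comparing with
    [beta / n] bounds [n] from below. *)

Section FiniteWeights.

(* [put b x] overwrites with [b] the part of [x] that [get] reads. *)
Lemma sum_resample (V : nmodType) (S B : finType)
    (get : S -> B) (put : B -> S -> S) :
    (forall b x, get (put b x) = b) ->
    (forall b c x, put b (put c x) = put b x) ->
    (forall x, put (get x) x = x) ->
  forall G : S -> V, \sum_x \sum_b G (put b x) = (\sum_x G x) *+ #|B|.
Proof.
move=> get_put put_put put_get G; rewrite pair_big /=.
pose swap (z : S * B) := (put z.2 z.1, get z.1).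
have swapK : involutive swap.
  by case=> x b; rewrite /swap /= get_put put_put put_get.
rewrite (reindex_inj (inv_inj swapK)) /=.
under eq_bigr => z _ do rewrite put_put put_get.
rewrite -(pair_big xpredT xpredT (fun x (_ : B) => G x)) /= -sumrMnl.
by apply: eq_bigr => x _; rewrite sumr_const.
Qed.

Lemma sum_prod_marginal (F : comNzRingType) (I T : finType) (w : I -> T -> F)
    (i : I) (f : T -> F) :
  \sum_(X : {ffun I -> T}) (\prod_j w j (X j)) * f (X i)
  = (\sum_t w i t * f t) * \prod_(j | j != i) \sum_t w j t.
Proof.
pose v j t := w j t * (if j == i then f t else 1).
transitivity (\sum_(X : {ffun I -> T}) \prod_j v j (X j)).
  apply: eq_bigr => X _; rewrite big_split /=; congr (_ * _).
  by rewrite (bigD1 i) //= eqxx big1 ?mulr1 // => j /negPf ->.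
rewrite -(bigA_distr_bigA v) (bigD1 i) //=; congr (_ * _).
  by apply: eq_bigr => t _; rewrite /v eqxx.
apply: eq_bigr => j /negPf ji; apply: eq_bigr => t _.
by rewrite /v ji mulr1.
Qed.

Lemma sum_prod_additive_le (F : realDomainType) (I T : finType)
    (w : I -> T -> F) (f : T -> F) (c : F) :
    (forall i t, 0 <= w i t) ->
    (forall i, \sum_t w i t * f t <= c * \sum_t w i t) ->
  \sum_(X : {ffun I -> T}) (\prod_j w j (X j)) * \sum_j f (X j)
  <= #|I|%:R * c * \sum_(X : {ffun I -> T}) \prod_j w j (X j).
Proof.
move=> w_ge0 mean_le.
under eq_bigr => X _ do rewrite mulr_sumr.
rewrite exchange_big /= -mulrA mulr_natl -sumr_const; apply: ler_sum => i _.
rewrite sum_prod_marginal -(bigA_distr_bigA w) [in leRHS](bigD1 i) //= mulrA.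
by rewrite ler_wpM2r // prodr_ge0 // => j _; apply: sumr_ge0.
Qed.

Lemma ler_sum_subpred (F : numDomainType) (T : finType) (P Q : pred T)
    (w : T -> F) :
    (forall x, 0 <= w x) -> subpred P Q ->
  \sum_(x | P x) w x <= \sum_(x | Q x) w x.
Proof.
move=> w_ge0 PQ; rewrite big_mkcond [leRHS]big_mkcond; apply: ler_sum => x _.
by case: ifP => [/PQ -> //|_]; case: ifP.
Qed.

Lemma ler_sum_predU (F : numDomainType) (T : finType) (P Q : pred T)
    (w : T -> F) :
    (forall x, 0 <= w x) ->
  \sum_(x | P x || Q x) w x <= \sum_(x | P x) w x + \sum_(x | Q x) w x.
Proof.
move=> w_ge0; rewrite big_mkcond [X in _ <= X + _]big_mkcond.
rewrite [X in _ <= _ + X]big_mkcond -big_split; apply: ler_sum => x _ /=.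
by case: (P x); case: (Q x); rewrite /= ?addr0 ?add0r ?lerDl.
Qed.

Lemma weighted_markov (F : realDomainType) (T : finType)
    (w f : T -> F) (t : F) :
    (forall x, 0 <= w x) -> (forall x, 0 <= f x) ->
  t * \sum_(x | ~~ (f x <= t)) w x <= \sum_x w x * f x.
Proof.
move=> w_ge0 f_ge0; rewrite mulr_sumr big_mkcond; apply: ler_sum => x _.
case: ifPn => [|_]; last by rewrite mulr_ge0.
by rewrite -ltNge => /ltW t_le; rewrite mulrC ler_wpM2l.
Qed.

Lemma weighted_chernoff (F : realType) (T : finType)
    (w S V : T -> F) (v t : F) :
    (forall x, 0 <= w x) ->
    \sum_x w x * expR (S x - V x) <= \sum_x w x ->
  \sum_(x | (V x <= v) && (t <= S x)) w x <= expR (v - t) * \sum_x w x.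
Proof.
move=> w_ge0 mgf_le; apply: le_trans (ler_wpM2l (expR_ge0 _) mgf_le).
rewrite mulr_sumr big_mkcond; apply: ler_sum => x _.
rewrite mulrCA -expRD; case: ifP => [/andP[Vv tS]|_].
  by rewrite ler_peMr // -expR0 ler_expR; lra.
by rewrite mulr_ge0 ?expR_ge0.
Qed.

Lemma weighted_chernoff_abs (F : realType) (T : finType) (w S V : T -> F)
    (v t th : F) :
    (forall x, 0 <= w x) -> 0 <= th ->
    (forall s, `|s| = th -> \sum_x w x * expR (s * S x - V x) <= \sum_x w x) ->
  \sum_(x | (V x <= v) && (t <= `|S x|)) w x
  <= 2 * expR (v - th * t) * \sum_x w x.
Proof.
move=> w_ge0 th_ge0 mgf_le.
have tail s : `|s| = th -> \sum_(x | (V x <= v) && (th * t <= s * S x)) w x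
    <= expR (v - th * t) * \sum_x w x.
  by move=> s_th; apply: weighted_chernoff => //; exact: mgf_le.
have right_tail := tail th (ger0_norm th_ge0).
have left_tail := tail (- th) (etrans (normrN th) (ger0_norm th_ge0)).
rewrite -mulrA mulr_natl mulr2n; apply: le_trans (lerD right_tail left_tail).
apply: le_trans (ler_sum_predU _ _ w_ge0); apply: ler_sum_subpred => // x.
case/andP=> -> /=; rewrite ler_normr mulNr -mulrN => /orP[] t_le.
  by rewrite ler_wpM2l.
by rewrite [X in _ || X]ler_wpM2l ?orbT.
Qed.

Lemma ler_sqr_norm (F : realDomainType) (x y : F) :
  `|x| <= y -> x ^+ 2 <= y ^+ 2.
Proof.
move=> xy; rewrite -[leLHS]real_normK ?num_real // lerXn2r // nnegrE.
exact: le_trans xy.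
Qed.

Lemma ler1_ord_size (F : numDomainType) (n : nat) (i : 'I_n) : 1 <= n%:R :> F.
Proof. by rewrite ler1n (leq_ltn_trans _ (ltn_ord i)). Qed.

Lemma exists_norm_ge_mean (F : realFieldType) (I : finType)
    (f : I -> F) (c : F) :
  (0 < #|I|)%N -> #|I|%:R * c <= `|\sum_i f i| -> exists i, c <= `|f i|.
Proof.
case/card_gt0P=> i0 _ c_le; apply: contrapT => /forallNP small.
have : `|\sum_i f i| < \sum_(i : I) c.
  apply: le_lt_trans (ler_norm_sum _ _ _) _; apply: ltr_sum => [|i _].
    by apply/hasP; exists i0; rewrite ?mem_index_enum.
  by rewrite ltNge; apply/negP.
by rewrite sumr_const -mulr_natl ltNge c_le.
Qed.

End FiniteWeights.

Section ExponentialBounds.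
Variable F : realType.

Lemma expR_le_quadratic (x : F) : x <= 1 / 2 -> expR x <= 1 + x + 2 * x ^+ 2.
Proof.
move=> x_le; have ex_gt0 := expR_gt0 x.
have : (1 - x) * expR x <= 1.
  rewrite -[leRHS](expRxMexpNx_1 x) mulrC ler_pM2l //.
  exact: expR_ge1Dx.
have x2_ge0 := sqr_ge0 x; rewrite expr2 in x2_ge0 *; nra.
Qed.

(* The variable equals [N - s] with weight [N + s] and [-(N + s)] with weight
   [N - s]; it is centred with second moment [N^2 - s^2]. *)
Lemma centred_two_point_mgf (N s t : F) :
    `|s| <= N -> `|t| * (4 * N) <= 1 ->
  (N + s) * expR (t * (N - s)) + (N - s) * expR (- (t * (N + s)))
  <= 2 * N * expR (2 * t ^+ 2 * (N ^+ 2 - s ^+ 2)).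
Proof.
rewrite ler_norml => /andP[s_ge s_le] t_small.
have t_bound x : 0 <= x <= 2 * N -> `|t * x| <= 1 / 2.
  case/andP=> x_ge0 x_le; rewrite normrM (ger0_norm x_ge0).
  by have := ler_wpM2l (normr_ge0 t) x_le; lra.
have up : t * (N - s) <= 1 / 2.
  by apply: le_trans (ler_norm _) _; apply: t_bound; apply/andP; split; lra.
have down : - (t * (N + s)) <= 1 / 2.
  rewrite (le_trans (ler_norm _)) // normrN; apply: t_bound.
  by apply/andP; split; lra.
have Ns_ge0 : 0 <= N + s by lra.
have sN_ge0 : 0 <= N - s by lra.
apply: (le_trans (lerD (ler_wpM2l Ns_ge0 (expR_le_quadratic up))
                       (ler_wpM2l sN_ge0 (expR_le_quadratic down)))).
have -> : (N + s) * (1 + t * (N - s) + 2 * (t * (N - s)) ^+ 2) +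
    (N - s) * (1 + - (t * (N + s)) + 2 * (- (t * (N + s))) ^+ 2)
    = 2 * N * (1 + 2 * t ^+ 2 * (N ^+ 2 - s ^+ 2)) by ring.
by rewrite ler_wpM2l ?expR_ge1Dx //; lra.
Qed.

End ExponentialBounds.

Section Clip.
Variable F : realType.
Implicit Types z : F.

Definition clip z : F := Num.max (-1) (Num.min z 1).

Lemma norm_clip_le1 z : `|clip z| <= 1.
Proof.
by rewrite /clip ler_norml !le_max !ge_max !ge_min !lexx ?orbT /= andbT; lra.
Qed.

Lemma dist_clip_le z : `|z - clip z| <= z ^+ 2 / 4.
Proof.
have := (sqr_ge0 (z - 2), sqr_ge0 (z + 2), sqr_ge0 z) => -[[]].
rewrite ler_norml /clip !expr2 => ge2 geN2 ge0.
have [z_le1|z_gt1] := leP z 1; last first.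
  rewrite (max_r (_ : -1 <= 1)); last by lra.
  by apply/andP; split; lra.
by have [z_geN1|z_ltN1] := leP (-1) z; apply/andP; split; lra.
Qed.

Lemma dist_sum_clip_le (I : finType) (z s : I -> F) (c : F) :
  (forall i, `|s i| <= c) ->
  `|\sum_i z i * s i - \sum_i clip (z i) * s i| <= (\sum_i z i ^+ 2) * c / 4.
Proof.
move=> s_le; rewrite -sumrB mulrAC -mulrA mulr_suml.
apply: le_trans (ler_norm_sum _ _ _) _; apply: ler_sum => i _.
by rewrite -mulrBl normrM mulrA ler_pM ?dist_clip_le.
Qed.

Lemma continuous_clip : continuous clip.
Proof.
apply: (@max_fun_continuous _ F F (fun=> -1) (fun z => Num.min z 1)).
  exact: cst_continuous.
apply: (@min_fun_continuous _ F F id (fun=> 1)); last exact: cst_continuous.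
by move=> z; exact: cvg_id.
Qed.

End Clip.

Section DotProduct.
Variable F : realFieldType.
Variable d : nat.
Implicit Types (u v w : 'rV[F]_d) (B : 'M[F]_d).

Definition dot u v : F := (u *m v^T) ord0 ord0.

Lemma dotE u v : dot u v = \sum_j u ord0 j * v ord0 j.
Proof. by rewrite /dot mxE; apply: eq_bigr => j _; rewrite mxE. Qed.

Lemma dotC u v : dot u v = dot v u.
Proof. by rewrite !dotE; apply: eq_bigr => j _; rewrite mulrC. Qed.

Lemma dotBl u v w : dot (u - v) w = dot u w - dot v w.
Proof. by rewrite /dot mulmxBl !mxE. Qed.

Lemma dotZl c u v : dot (c *: u) v = c * dot u v.
Proof. by rewrite /dot -scalemxAl mxE. Qed.

Lemma dot_suml (I : finType) (f : I -> 'rV[F]_d) v :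
  dot (\sum_i f i) v = \sum_i dot (f i) v.
Proof. by rewrite /dot mulmx_suml summxE. Qed.

Lemma dotBr u v w : dot w (u - v) = dot w u - dot w v.
Proof. by rewrite dotC dotBl !(dotC w). Qed.

Lemma dotZr c u v : dot u (c *: v) = c * dot u v.
Proof. by rewrite dotC dotZl dotC. Qed.

Lemma dot_ge0 u : 0 <= dot u u.
Proof. by rewrite dotE; apply: sumr_ge0 => j _; rewrite -expr2 sqr_ge0. Qed.

Lemma dot_eq0 u : (dot u u == 0) = (u == 0).
Proof.
apply/eqP/eqP => [|->]; last by rewrite /dot mul0mx mxE.
rewrite dotE => /eqP; rewrite psumr_eq0 => [/allP u0|j _]; last first.
  by rewrite -expr2 sqr_ge0.
apply/rowP => j; rewrite mxE; apply/eqP; rewrite -sqrf_eq0 expr2.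
by apply: u0; rewrite mem_index_enum.
Qed.

Lemma dot_gt0 u : (0 < dot u u) = (u != 0).
Proof. by rewrite lt_neqAle eq_sym dot_eq0 dot_ge0 andbT. Qed.

Lemma dot_cauchy_schwarz u v : dot u v ^+ 2 <= dot u u * dot v v.
Proof.
have [->|v_neq0] := eqVneq v 0.
  by rewrite dotC /dot !mul0mx mxE mulr0 expr0n.
have v_gt0 : 0 < dot v v by rewrite dot_gt0.
rewrite -subr_ge0 -(pmulr_rge0 _ v_gt0).
have := dot_ge0 (dot v v *: u - dot u v *: v).
by rewrite !(dotBl, dotBr, dotZl, dotZr) (dotC v u); congr (_ <= _); ring.
Qed.

(* The quadratic form of [B] along [v - t (v B)] is [- 2 t |v B|^2 + O(t^2)],
   which is negative for small [t] unless [v B = 0]. *)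
Lemma psd_isotropic_ker B v :
    B^T = B -> (forall u, 0 <= dot (u *m B) u) -> dot (v *m B) v = 0 ->
  v *m B = 0.
Proof.
move=> B_sym B_psd vBv; set w := v *m B; apply/eqP; rewrite -dot_eq0.
have wBv : dot (w *m B) v = dot w w.
  by rewrite /dot -mulmxA -{1}B_sym -trmx_mul.
set q := dot (w *m B) w; set r := dot w w in wBv *.
have q_ge0 : 0 <= q := B_psd w.
pose t := r / (q + 1).
have tq : t * (q + 1) = r by rewrite divfK // gt_eqF // ltr_wpDl.
have := B_psd (v - t *: w).
rewrite mulmxBl -scalemxAl -/w !(dotBl, dotBr, dotZl, dotZr) vBv wBv -/q -/r.
rewrite (_ : _ - _ = - (t ^+ 2 * (q + 2))); last by rewrite -tq; ring.
rewrite oppr_ge0 => t2_le0; have : t ^+ 2 * (q + 2) == 0.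
  by rewrite eq_le t2_le0 mulr_ge0 ?sqr_ge0 //; lra.
rewrite mulf_eq0 sqrf_eq0 => /orP[/eqP t0|]; first by rewrite -tq t0 mul0r.
by rewrite gt_eqF //; lra.
Qed.

End DotProduct.

Lemma sqr_sum_le (F : realFieldType) (n : nat) (f : 'I_n -> F) :
  (\sum_i f i) ^+ 2 <= n%:R * \sum_i f i ^+ 2.
Proof.
have := dot_cauchy_schwarz (\row_i f i) (const_mx 1).
rewrite !dotE mulrC; under eq_bigr do rewrite !mxE mulr1.
under [in X in _ <= X * _]eq_bigr do rewrite !mxE mulr1.
under [in X in _ <= _ * X]eq_bigr do rewrite !mxE -expr2.
by rewrite sumr_const card_ord.
Qed.

Section Spectrum.

Lemma trace_sum_roots (F : comNzRingType) (d : nat) (A : 'M[F]_d) (s : seq F) :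
    size s = d -> char_poly A = \prod_(a <- s) ('X - a%:P) ->
  \tr A = \sum_(a <- s) a.
Proof.
case: d A => [|d] A size_s chA.
  by rewrite (size0nil size_s) big_nil /mxtrace big_ord0.
have := @char_poly_trace _ _ A isT; have := @coefPn_prod_XsubC _ s.
by rewrite chA size_s => /(_ isT) -> /oppr_inj.
Qed.

Lemma eigenvalue_roots (F : fieldType) (d : nat) (A : 'M[F]_d)
    (s : seq F) (x : F) :
  char_poly A = \prod_(a <- s) ('X - a%:P) -> eigenvalue A x = (x \in s).
Proof. by move=> chA; rewrite eigenvalue_root_char chA root_prod_XsubC. Qed.

Lemma sorted_ge_nth0 (F : realDomainType) (s : seq F) (x : F) :
  sorted (fun a b => b <= a) s -> x \in s -> x <= s`_0.
Proof.
case: s => // y s /= y_s; rewrite inE => /predU1P[-> //|].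
by apply/allP: x; apply: order_path_min y_s => a b c /= ba /le_trans; apply.
Qed.

Lemma sum_ge_nth01 (F : realDomainType) (s : seq F) :
  {in s, forall x, 0 <= x} -> s`_0 + s`_1 <= \sum_(x <- s) x.
Proof.
case: s => [|x [|y s]] s_ge0; rewrite ?big_nil ?addr0 // ?big_seq1 ?addr0 //.
rewrite !big_cons addrA lerDl big_seq; apply: sumr_ge0 => z zs.
by apply: s_ge0; rewrite !inE zs !orbT.
Qed.

End Spectrum.

Section UnitRows.
Context {n d : nat}.
Implicit Types (X : 'M[R]_(n, d)) (u v y : 'rV[R]_d).

Definition rowsum X : 'rV[R]_d := \sum_i row i X.

Lemma sqnormE u : sqnorm u = dot u u.
Proof. by rewrite dotE; apply: eq_bigr => j _; rewrite expr2. Qed.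

Lemma sqnormXyE X y : sqnormXy X y = \sum_i dot (row i X) y ^+ 2.
Proof.
apply: eq_bigr => i _; rewrite dotE; congr (_ ^+ 2).
by apply: eq_bigr => j _; rewrite mxE.
Qed.

Lemma sqnormXy_quadratic X y : sqnormXy X y = dot (y *m (X^T *m X)) y.
Proof.
have -> : dot (y *m (X^T *m X)) y = dot (y *m X^T) (y *m X^T).
  by rewrite /dot trmx_mul trmxK !mulmxA.
rewrite sqnormXyE dotE; apply: eq_bigr => i _; rewrite -expr2; congr (_ ^+ 2).
by rewrite dotC dotE mxE; apply: eq_bigr => j _; rewrite !mxE.
Qed.

Lemma sqnormXy_ge0 X y : 0 <= sqnormXy X y.
Proof. by apply: sumr_ge0 => i _; exact: sqr_ge0. Qed.

Lemma sqnormXyZ X c y : sqnormXy X (c *: y) = c ^+ 2 * sqnormXy X y.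
Proof.
by rewrite !sqnormXyE mulr_sumr; apply: eq_bigr => i _; rewrite dotZr exprMn.
Qed.

Lemma trace_gram X : dataset X -> \tr (X^T *m X) = n%:R.
Proof.
move=> dX; rewrite mxtrace_mulC /mxtrace (eq_bigr (fun=> 1)) => [|i _].
  by rewrite sumr_const card_ord.
rewrite -(dX i) sqnormE /dot tr_row -row_mul !mxE.
by apply: eq_bigr => j _; rewrite !mxE.
Qed.

Lemma top_right_sv_le X v u :
  top_right_sv X v -> sqnormXy X u <= sqnormXy X v * sqnorm u.
Proof.
case=> _ v_max; have [->|u_neq0] := eqVneq u 0.
  by rewrite -[0](scale0r 0) sqnormXyZ expr0n mul0r sqnormE dotZl !mul0r mulr0.
have u_gt0 : 0 < sqnorm u by rewrite sqnormE dot_gt0.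
have scale_sqr : (Num.sqrt (sqnorm u))^-1 ^+ 2 = (sqnorm u)^-1.
  by rewrite exprVn sqr_sqrtr // ltW.
have := v_max ((Num.sqrt (sqnorm u))^-1 *: u).
rewrite sqnormXyZ scale_sqr /sphere /= sqnormE dotZl dotZr -sqnormE mulrA.
by rewrite -expr2 scale_sqr mulVf ?gt_eqF // mulrC ler_pdivrMr // => /(_ erefl).
Qed.

Lemma top_right_sv_eigenvalue X v :
  top_right_sv X v -> eigenvalue (X^T *m X) (sqnormXy X v).
Proof.
move=> tv; set mu := sqnormXy X v.
have v_unit : dot v v = 1 by rewrite -sqnormE tv.1.
apply/eigenvalueP; exists v; last by rewrite -dot_eq0 v_unit oner_eq0.
have gap u : dot (u *m (mu%:M - X^T *m X)) u = mu * sqnorm u - sqnormXy X u.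
  by rewrite mulmxBr mul_mx_scalar dotBl dotZl -sqnormE -sqnormXy_quadratic.
apply/esym/eqP; rewrite -subr_eq0 -mul_mx_scalar -mulmxBr.
apply/eqP/psd_isotropic_ker.
- by rewrite linearB /= tr_scalar_mx trmx_mul trmxK.
- by move=> u; rewrite gap subr_ge0 top_right_sv_le.
- by rewrite gap sqnormE v_unit mulr1 subrr.
Qed.

Lemma eigenvalue_gram_ge0 X x : eigenvalue (X^T *m X) x -> 0 <= x.
Proof.
case/eigenvalueP=> u ux u_neq0.
have u_gt0 : 0 < dot u u by rewrite dot_gt0.
by rewrite -(pmulr_lge0 _ u_gt0) -dotZl -ux -sqnormXy_quadratic sqnormXy_ge0.
Qed.

(* The squared singular values of [X] add up to [n], and the largest of them is
   at least [|X v|^2]. *)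
Lemma singular_value_ratio X v (g : R) :
    dataset X -> top_right_sv X v -> 0 <= g ->
    n%:R - sqnormXy X v <= g ^+ 2 * sqnormXy X v ->
  singular_value X 2 <= g * singular_value X 1.
Proof.
move=> dX tv g_ge0 gap; rewrite /singular_value /=.
case: xgetP => [s _ [size_s s_sorted chX]|_]; last first.
  by rewrite !nth_nil sqrtr0 mulr0.
have top_le : sqnormXy X v <= s`_0.
  apply: sorted_ge_nth0 => //.
  by rewrite -(eigenvalue_roots _ chX) top_right_sv_eigenvalue.
have s_ge0 : {in s, forall x, 0 <= x}.
  by move=> x; rewrite -(eigenvalue_roots _ chX); exact: eigenvalue_gram_ge0.
have := sum_ge_nth01 s_ge0.
rewrite -(trace_sum_roots size_s chX) trace_gram // => s01.
rewrite -[g]ger0_norm // -sqrtr_sqr -sqrtrM ?sqr_ge0 // ler_wsqrtr //.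
by have := ler_wpM2l (sqr_ge0 g) top_le; lra.
Qed.

Lemma sqnorm_rowsum_le X v :
  top_right_sv X v -> sqnorm (rowsum X) <= n%:R * sqnormXy X v.
Proof.
move=> tv; set S := rowsum X.
have [S_le0|S_gt0] := leP (sqnorm S) 0.
  by apply: le_trans S_le0 _; rewrite mulr_ge0 ?sqnormXy_ge0.
rewrite -(ler_pM2r S_gt0) -mulrA.
apply: le_trans (ler_wpM2l (ler0n _ _) (top_right_sv_le S tv)).
rewrite -expr2 sqnormE {1}/S dot_suml sqnormXyE; exact: sqr_sum_le.
Qed.

(* Dispersion of the rows [x_i] around their mean decreases under projection to
   the line of [y]; the mean is multiplied by [n] to avoid divisions. *)
Lemma dispersion_project_le X y :
    (0 < n)%N -> dataset X -> sphere d y ->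
  n%:R * sqnormXy X y - dot (rowsum X) y ^+ 2 <= n%:R ^+ 2 - sqnorm (rowsum X).
Proof.
move=> n_gt0 dX y_unit; set S := rowsum X.
have n_pos : 0 < n%:R :> R by rewrite ltr0n.
have const (c : R) : \sum_(i < n) c = n%:R * c.
  by rewrite sumr_const card_ord mulr_natl.
pose c i := n%:R *: row i X - S.
have : \sum_i dot (c i) y ^+ 2 <= \sum_i dot (c i) (c i).
  apply: ler_sum => i _; apply: le_trans (dot_cauchy_schwarz _ _) _.
  by rewrite -(sqnormE y) y_unit mulr1.
have -> : \sum_i dot (c i) y ^+ 2 = n%:R * (n%:R * sqnormXy X y - dot S y ^+ 2).
  transitivity (\sum_i (n%:R ^+ 2 * dot (row i X) y ^+ 2
      - 2 * n%:R * dot S y * dot (row i X) y + dot S y ^+ 2)).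
    by apply: eq_bigr => i _; rewrite dotBl dotZl; ring.
  rewrite big_split sumrB /= -!mulr_sumr -dot_suml -sqnormXyE const -/S; ring.
have -> : \sum_i dot (c i) (c i) = n%:R * (n%:R ^+ 2 - sqnorm S).
  transitivity (\sum_i (n%:R ^+ 2 - 2 * n%:R * dot (row i X) S + sqnorm S)).
    apply: eq_bigr => i _; rewrite !(dotBl, dotBr, dotZl, dotZr) -!sqnormE dX.
    by rewrite (dotC S); ring.
  rewrite big_split sumrB /= -!mulr_sumr -dot_suml !const -/S sqnormE; ring.
by rewrite ler_pM2l.
Qed.

Lemma dot_rowsum_sqr_ge X v y (e l : R) :
    (0 < n)%N -> dataset X -> top_right_sv X v -> sphere d y ->
    (1 - e) * n%:R ^+ 2 <= sqnorm (rowsum X) ->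
    sqnormXy X v - l * n%:R <= sqnormXy X y ->
  (1 - 2 * e - l) * n%:R ^+ 2 <= dot (rowsum X) y ^+ 2.
Proof.
move=> n_gt0 dX tv y_unit aligned accurate.
have spread := dispersion_project_le n_gt0 dX y_unit.
have top := sqnorm_rowsum_le tv.
have := ler_wpM2l (ler0n R n) accurate.
by rewrite mulrBr (mulrCA _ l) -expr2; lra.
Qed.

End UnitRows.

Section SphereTopology.

Lemma continuous_sum (F : realType) (T : topologicalType) (I : finType)
    (f : I -> T -> F) :
  (forall i, continuous (f i)) -> continuous (fun x => \sum_i f i x).
Proof.
move=> cf; apply: continuous_big => [|i _]; first exact: add_continuous.
exact: cf.
Qed.

Lemma continuous_dot (d : nat) (u : 'rV[R]_d) : continuous (dot u).
Proof.
rewrite (_ : dot u = fun y => \sum_j u ord0 j * y ord0 j).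
  apply: continuous_sum => j y.
  apply: (@continuousM _ _ (fun=> u ord0 j) (fun y : 'rV[R]_d => y ord0 j)).
    exact: cst_continuous.
  exact: coord_continuous.
by apply/funext => y; rewrite dotE.
Qed.

Lemma continuous_sqnormXy (n d : nat) (X : 'M[R]_(n, d)) :
  continuous (sqnormXy X).
Proof.
rewrite (_ : sqnormXy X = fun y => \sum_i dot (row i X) y * dot (row i X) y).
  apply: continuous_sum => i y.
  by apply: (@continuousM _ _ (dot (row i X)) (dot (row i X)));
    exact: continuous_dot.
by apply/funext => y; rewrite sqnormXyE; apply: eq_bigr => i _; rewrite expr2.
Qed.

Lemma sqnormXy_id (d : nat) : sqnormXy 1%:M = @sqnorm d.
Proof.
by apply/funext => y; rewrite sqnormXy_quadratic trmx1 !mulmx1 sqnormE.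
Qed.

Lemma closed_sphere (d : nat) : closed (sphere d).
Proof.
apply: (@preimage_closed _ _ (@sqnorm d) [set x | x = 1]%classic);
  last exact: closed_eq.
by move=> y _; rewrite -sqnormXy_id; exact: continuous_sqnormXy.
Qed.

Lemma compact_sphere (d : nat) : compact (sphere d).
Proof.
apply: bounded_closed_compact; last exact: closed_sphere.
exists 1; split; first exact: num_real.
move=> M M_gt1 y y_unit; rewrite /Num.Def.normr /= mx_normrE.
apply/bigmax_leP; split; first by rewrite ltW // (lt_trans ltr01).
move=> [i j] _ /=; rewrite (ord1 i); apply: le_trans (ltW M_gt1).
rewrite -(@expr_le1 _ 2) // real_normK ?num_real // -y_unit /sqnorm.
rewrite (bigD1 j) //= lerDl.
by apply: sumr_ge0 => k _; exact: sqr_ge0.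
Qed.

Lemma top_right_sv_exists (n d : nat) (X : 'M[R]_(n, d)) :
  (0 < d)%N -> exists v, top_right_sv X v.
Proof.
case: d X => // d X _.
have sphere_neq0 : (sphere d.+1 !=set0)%classic.
  exists (delta_mx ord0 ord0); rewrite /sphere /= sqnormE /dot.
  by rewrite trmx_delta mul_delta_mx mxE !eqxx.
have [v /set_mem v_unit v_max] := EVT_max_rV sphere_neq0 (@compact_sphere d.+1)
  (continuous_subspaceT (@continuous_sqnormXy n d.+1 X)).
by exists v; split=> // u u_unit; apply: v_max; exact: mem_set.
Qed.

End SphereTopology.

Section Measurability.
Variable d : nat.

Lemma measurable_closed (A : set 'rV[R]_d) :
  closed A -> measurable (A : set (vecB d)).
Proof.
move=> cA; rewrite -[A]setCK; apply: measurableC.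
by apply: sub_sigma_algebra; exact: closed_openC.
Qed.

Lemma measurable_ge_continuous (f : 'rV[R]_d -> R) (c : R) :
  continuous f -> measurable ([set y | c <= f y]%classic : set (vecB d)).
Proof.
move=> cf; apply: measurable_closed.
apply: (@preimage_closed _ _ f [set x | c <= x]%classic); last exact: closed_ge.
by move=> y _; exact: cf.
Qed.

End Measurability.

Section FiniteProbability.
Context {disp : measure_display} {T : measurableType disp} {F : realType}.
Variable P : probability T F.
Implicit Types A B S : set T.

Definition pr A : F := fine (P A).

Lemma EFin_pr A : measurable A -> (pr A)%:E = P A.
Proof. by move=> mA; rewrite fineK // fin_num_measure. Qed.

Lemma pr_ge0 A : 0 <= pr A.
Proof. exact: fine_ge0. Qed.

Lemma union_bound (I : finType) A S (B : I -> set T) :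
    measurable A -> measurable S -> (forall i, measurable (B i)) -> P S = 1%E ->
    (forall y, A y -> S y -> exists i, B i y) ->
  pr A <= \sum_i pr (B i).
Proof.
move=> mA mS mB S1 cover; have PSC0 : P (~` S)%classic = 0%E.
  by rewrite probability_setC // S1 subee.
rewrite -lee_fin -sumEFin EFin_pr //.
under eq_bigr do rewrite EFin_pr //.
rewrite -(measureU0 mA (measurableC mS) PSC0).
have -> : (A `|` ~` S = (A `&` S) `|` ~` S)%classic.
  by rewrite setUIl setUCr setIT.
rewrite measureU0 //; [|exact: measurableI|exact: measurableC].
have [mU U_le] : measurable (\big[setU/set0]_i B i)%classic /\
    (P (\big[setU/set0]_i B i)%classic <= \sum_i P (B i))%E.
  apply: (big_ind2 (fun C c => measurable C /\ (P C <= c)%E))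
    => [|C1 c1 C2 c2|i _].
  - by rewrite measure0.
  - move=> [mC1 C1_le] [mC2 C2_le]; split; first exact: measurableU.
    by rewrite (le_trans (measureU2 _ mC1 mC2)) ?leeD.
  - by [].
apply: le_trans U_le; rewrite le_measure ?inE //; first exact: measurableI.
move=> y [/cover cover_y /cover_y[i Biy]].
by rewrite -bigcup_seq; exists i => //=; rewrite mem_index_enum.
Qed.

Lemma sum_pr_le (I : finType) (w : I -> F) (B : I -> set T) (c : F) :
    (forall i, measurable (B i)) -> (forall i, 0 <= w i) ->
    (forall y, \sum_i w i * \1_(B i) y <= c) ->
  \sum_i w i * pr (B i) <= c.
Proof.
move=> mB w_ge0 sum_le; rewrite -lee_fin -sumEFin.
have indic_ge0 i y : (0 <= (w i * \1_(B i) y)%:E)%E by rewrite lee_fin mulr_ge0.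
have mindic i : measurable_fun setT (fun y => (w i * \1_(B i) y)%:E).
  apply/measurable_EFinP; apply: measurable_funM; first exact: measurable_cst.
  exact: measurable_indic.
have -> : (\sum_i (w i * pr (B i))%:E
    = \int[P]_y \sum_i (w i * \1_(B i) y)%:E)%E.
  rewrite ge0_integral_sum //; apply: eq_bigr => i _.
  under eq_integral do rewrite EFinM.
  rewrite ge0_integralZl_EFin //; last first.
    by apply/measurable_EFinP; exact: measurable_indic.
  by rewrite integral_indic // setIT EFinM EFin_pr.
apply: (@le_trans _ _ (\int[P]_y (cst c%:E y))%E).
  apply: ge0_le_integral => //.
  - by move=> y _; apply: sume_ge0.
  - exact: emeasurable_sum.
  - by move=> y _; rewrite sumEFin lee_fin.
by rewrite integral_cst // [X in (_ * X)%E](@probability_setT _ _ _ P) mule1.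
Qed.

End FiniteProbability.

Local Notation bits n := {ffun 'I_n -> bool}.

Section BitVectors.
Context {n : nat}.
Implicit Types (i k : 'I_n) (w : bits n).

Definition upd i (b : bool) w : bits n := [ffun k => if k == i then b else w k].

Lemma upd_eq i b w : upd i b w i = b.
Proof. by rewrite ffunE eqxx. Qed.

Lemma upd_neq i k b w : k != i -> upd i b w k = w k.
Proof. by rewrite ffunE => /negPf ->. Qed.

Lemma upd_upd i b c w : upd i b (upd i c w) = upd i b w.
Proof. by apply/ffunP => k; rewrite !ffunE; case: eqP. Qed.

Lemma upd_id i w : upd i (w i) w = w.
Proof. by apply/ffunP => k; rewrite ffunE; case: eqP => // ->. Qed.

End BitVectors.

(* The total mass of the urn just before the last of [n] draws. *)
Definition urn_mass (F : realFieldType) (n : nat) (a : F) : F :=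
  n%:R - 1 + 2 * a.

Section Urn.
Context {F : realFieldType} {n : nat}.
Implicit Types (a : F) (i k : 'I_n) (w : bits n).

Definition spin (b : bool) : F := if b then 1 else -1.

Definition rising a (m : nat) : F := \prod_(l < m) (a + l%:R).

(* Up to normalisation, the law of the first [n] draws from a Polya urn that
   starts with a mass [a] of either colour. *)
Definition polya a w : F := rising a (\sum_i w i) * rising a (\sum_i ~~ w i).

Definition colsum w : F := \sum_i spin (w i).

Definition colsum_off i w : F := \sum_(k | k != i) spin (w k).

(* Given the other draws, [spin (w i)] has mean [colsum_off i w / urn_mass n a];
   the score is its centred value scaled by [urn_mass n a]. *)
Definition score a i w : F := urn_mass n a * spin (w i) - colsum_off i w.

Definition score_var a i w : F := urn_mass n a ^+ 2 - colsum_off i w ^+ 2.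

Definition disagreement w : F := n%:R ^+ 2 - colsum w ^+ 2.

Lemma sqr_spin b : spin b ^+ 2 = 1.
Proof. by case: b; rewrite /spin ?sqrrN expr1n. Qed.

Lemma spinE b : spin b = b%:R - (~~ b)%:R.
Proof. by case: b; rewrite /spin ?subr0 ?sub0r. Qed.

Lemma norm_spin b : `|spin b| = 1.
Proof. by case: b; rewrite /spin ?normrN normr1. Qed.

Lemma colsumE i w : colsum w = spin (w i) + colsum_off i w.
Proof. by rewrite /colsum (bigD1 i). Qed.

Lemma colsum_off_upd i b w : colsum_off i (upd i b w) = colsum_off i w.
Proof. by apply: eq_bigr => k ki; rewrite upd_neq. Qed.

Lemma card_others i : #|[pred k | k != i]|%:R = n%:R - 1 :> F.
Proof.
by rewrite (cardC1 i) card_ord -subn1 natrB // (leq_ltn_trans _ (ltn_ord i)).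
Qed.

Lemma norm_sum_spin_le (P : pred 'I_n) w :
  `|\sum_(k | P k) spin (w k)| <= #|P|%:R.
Proof.
apply: le_trans (ler_norm_sum _ _ _) _; rewrite -sum1_card natr_sum.
by apply: ler_sum => k _; rewrite norm_spin.
Qed.

Lemma norm_colsum_le w : `|colsum w| <= n%:R.
Proof. by have := norm_sum_spin_le xpredT w; rewrite card_ord. Qed.

Lemma norm_colsum_off_le i w : `|colsum_off i w| <= n%:R - 1.
Proof. by rewrite -(card_others i); exact: norm_sum_spin_le. Qed.

Lemma disagreement_ge0 w : 0 <= disagreement w.
Proof.
by rewrite subr_ge0 ler_sqr_norm ?norm_colsum_le.
Qed.

Lemma rising_gt0 a m : 0 < a -> 0 < rising a m.
Proof. by move=> a_gt0; apply: prodr_gt0 => l _; rewrite ltr_wpDr ?ler0n. Qed.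

Lemma risingS a m : rising a m.+1 = rising a m * (a + m%:R).
Proof. exact: big_ord_recr. Qed.

Lemma polya_gt0 a w : 0 < a -> 0 < polya a w.
Proof. by move=> a_gt0; rewrite mulr_gt0 ?rising_gt0. Qed.

Lemma polya_upd a i w : 0 < a ->
  exists2 c, 0 < c &
    forall b, polya a (upd i b w)
      = c * (urn_mass n a + spin b * colsum_off i w).
Proof.
move=> a_gt0.
pose p : nat := (\sum_(k | k != i) w k)%N.
pose m : nat := (\sum_(k | k != i) ~~ w k)%N.
have count_upd (f : bool -> nat) b :
    (\sum_k f (upd i b w k) = f b + \sum_(k | k != i) f (w k))%N.
  rewrite (bigD1 i) //= upd_eq; congr addn.
  by apply: eq_bigr => k ki; rewrite upd_neq.
have pm_sum : p%:R + m%:R = n%:R - 1 :> F.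
  rewrite -(card_others i) -natrD -big_split -sum1_card; congr (_%:R).
  by apply: eq_bigr => k _; case: (w k).
have pm_diff : p%:R - m%:R = colsum_off i w.
  by rewrite /colsum_off !natr_sum -sumrB; apply: eq_bigr => k _; rewrite spinE.
exists (rising a p * rising a m / 2).
  by rewrite divr_gt0 ?mulr_gt0 ?rising_gt0.
move=> b; rewrite /polya (count_upd nat_of_bool).
rewrite (count_upd (fun b => ~~ b : nat)).
rewrite -/p -/m /urn_mass -pm_sum -pm_diff.
by case: b; rewrite /= add0n add1n risingS /spin; field.
Qed.

Lemma sum_upd (V : nmodType) i (G : bits n -> V) :
  \sum_w \sum_b G (upd i b w) = (\sum_w G w) *+ 2.
Proof.
rewrite (sum_resample (fun b w => upd_eq i b w) (upd_upd i) (upd_id i)).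
by rewrite card_bool.
Qed.

Lemma sum_polya_score a i (G : bits n -> F) :
    0 < a -> (forall b w, G (upd i b w) = G w) ->
  \sum_w polya a w * (G w * score a i w) = 0.
Proof.
move=> a_gt0 G_upd; apply/eqP; rewrite -[_ == 0](mulrn_eq0 _ 2) -(sum_upd i).
apply/eqP/big1 => w _; have [c _ polyaE] := polya_upd i w a_gt0.
rewrite big_bool /= !polyaE !G_upd /score !upd_eq !colsum_off_upd /spin.
by ring.
Qed.

Lemma sum_score a w : \sum_i score a i w = 2 * a * colsum w.
Proof.
transitivity (\sum_i ((n%:R + 2 * a) * spin (w i) - colsum w)).
  by apply: eq_bigr => i _; rewrite /score /urn_mass (colsumE i); ring.
by rewrite sumrB -mulr_sumr -/(colsum w) sumr_const card_ord -mulr_natl; ring.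
Qed.

Lemma disagreement_mean a : 0 < a ->
  (1 + 2 * a) * \sum_w polya a w * disagreement w
  = 2 * a * n%:R * (n%:R - 1) * \sum_w polya a w.
Proof.
move=> a_gt0; apply/eqP; rewrite -subr_eq0 !mulr_sumr -sumrB -oppr_eq0 -sumrN.
have colsum_offE i w : colsum_off i w = colsum w - spin (w i).
  by rewrite (colsumE i) addrC addKr.
rewrite (eq_bigr (fun w => \sum_i polya a w * (colsum_off i w * score a i w))).
  rewrite exchange_big big1 //= => i _.
  by apply: sum_polya_score => // b w; exact: colsum_off_upd.
move=> w _; rewrite -mulr_sumr (eq_bigr (fun i =>
    (urn_mass n a + 2) * colsum w * spin (w i)
    - (urn_mass n a + 1 + colsum w ^+ 2))).
  rewrite sumrB -mulr_sumr -/(colsum w) sumr_const card_ord -mulr_natl.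
  by rewrite /urn_mass /disagreement; ring.
move=> i _; have := sqr_spin (w i); rewrite expr2 /score colsum_offE => spin2.
by ring: spin2.
Qed.

Lemma disagreement_mean_le a : 0 < a ->
  \sum_w polya a w * disagreement w <= 2 * a * n%:R ^+ 2 * \sum_w polya a w.
Proof.
move=> a_gt0; set D := \sum_w _; set Z := \sum_w _.
have Z_ge0 : 0 <= Z by apply: sumr_ge0 => w _; rewrite ltW ?polya_gt0.
have D_ge0 : 0 <= D.
  apply: sumr_ge0 => w _.
  by rewrite mulr_ge0 ?disagreement_ge0 // ltW ?polya_gt0.
have aD_ge0 : 0 <= a * D by rewrite mulr_ge0 // ltW.
have anZ_ge0 : 0 <= a * n%:R * Z by rewrite !mulr_ge0 // ltW.
by have := disagreement_mean a_gt0; rewrite -/D -/Z; lra.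
Qed.

Lemma norm_colsum_off_le_urn_mass a i w :
  0 <= a -> `|colsum_off i w| <= urn_mass n a.
Proof.
move=> a_ge0; apply: le_trans (norm_colsum_off_le i w) _.
by rewrite lerDl mulr_ge0.
Qed.

Lemma score_var_ge0 a i w : 0 <= a -> 0 <= score_var a i w.
Proof.
by move=> a_ge0; rewrite subr_ge0 ler_sqr_norm ?norm_colsum_off_le_urn_mass.
Qed.

Lemma score_var_le_disagreement a i w :
  0 < a <= 1 -> score_var a i w <= disagreement w + 4 * a * n%:R ^+ 2.
Proof.
case/andP=> a_gt0 a_le1.
have n_ge1 : 1 <= n%:R :> F := ler1_ord_size F i.
have an_le : a * n%:R <= a * n%:R ^+ 2 by rewrite ler_pM2l // expr2 ler_peMl.
have aa_le : a ^+ 2 <= a by rewrite expr2 ger_pMl.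
have spin_off_le : spin (w i) * colsum_off i w <= n%:R - 1.
  apply: le_trans (ler_norm _) _; rewrite normrM norm_spin mul1r.
  exact: norm_colsum_off_le.
have := sqr_spin (w i).
by rewrite /score_var /disagreement /urn_mass (colsumE i); lra.
Qed.

End Urn.

Lemma polya_score_mgf (F : realType) (n : nat) (a t : F) (i : 'I_n)
    (w : bits n) :
    0 < a -> `|t| * (4 * urn_mass n a) <= 1 ->
  \sum_b polya a (upd i b w) *
    expR (t * score a i (upd i b w) - 2 * t ^+ 2 * score_var a i (upd i b w))
  <= \sum_b polya a (upd i b w).
Proof.
move=> a_gt0 t_small; have [c c_gt0 polyaE] := polya_upd i w a_gt0.
rewrite !big_bool /= !polyaE /score /score_var !upd_eq !colsum_off_upd /spin.
set N := urn_mass n a; set s := colsum_off i w; set v := 2 * _ * _.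
rewrite !expRD mulr1 !mulrN1 !mul1r mulN1r.
have off_le := norm_colsum_off_le_urn_mass i w (ltW a_gt0).
have mgf := centred_two_point_mgf off_le t_small.
rewrite -/N -/s -/v in mgf.
have -> : c * (N + s) * (expR (t * (N - s)) * expR (- v)) +
    c * (N - s) * (expR (t * (- N - s)) * expR (- v))
    = c * expR (- v) *
      ((N + s) * expR (t * (N - s)) + (N - s) * expR (- (t * (N + s)))).
  by rewrite -opprD mulrN; ring.
have cv_ge0 : 0 <= c * expR (- v) by rewrite mulr_ge0 ?expR_ge0 // ltW.
apply: le_trans (ler_wpM2l cv_ge0 mgf) _.
have -> : c * expR (- v) * (2 * N * expR v)
    = c * (2 * N) * (expR v * expR (- v)) by ring.
by rewrite expRxMexpNx_1 mulr1; lra.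
Qed.

Local Notation code n d := {ffun 'I_d -> bits n}.

Section Code.
Context {n d : nat}.
Implicit Types (i : 'I_n) (b : bits d) (X : code n d).

Definition setrow i b X : code n d := [ffun j => upd i (b j) (X j)].

Definition coderow i X : bits d := [ffun j => X j i].

Lemma coderow_setrow i b X : coderow i (setrow i b X) = b.
Proof. by apply/ffunP => j; rewrite !ffunE eqxx. Qed.

Lemma setrow_setrow i b b' X : setrow i b (setrow i b' X) = setrow i b X.
Proof. by apply/ffunP => j; rewrite !ffunE upd_upd. Qed.

Lemma setrow_coderow i X : setrow i (coderow i X) X = X.
Proof. by apply/ffunP => j; rewrite !ffunE upd_id. Qed.

Lemma sum_setrow (V : nmodType) i (G : code n d -> V) :
  \sum_X \sum_b G (setrow i b X) = (\sum_X G X) *+ 2 ^ d.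
Proof.
rewrite (sum_resample (coderow_setrow i) (setrow_setrow i) (setrow_coderow i)).
by rewrite card_ffun card_bool card_ord.
Qed.

Section Mass.
Context {F : realFieldType}.
Implicit Types (a : F) (Y : 'I_d -> F).

Definition code_mass a X : F := \prod_j polya a (X j).

Definition code_disagreement X : F := \sum_j disagreement (X j).

Definition coherent a X : bool :=
  code_disagreement X <= 4 * a * n%:R ^+ 2 * d%:R.

Definition code_score a i X Y : F := \sum_j Y j * score a i (X j).

Definition code_score_var a i X Y : F := \sum_j Y j ^+ 2 * score_var a i (X j).

Lemma code_mass_gt0 a X : 0 < a -> 0 < code_mass a X.
Proof. by move=> a_gt0; apply: prodr_gt0 => j _; exact: polya_gt0. Qed.

Lemma code_disagreement_ge0 X : 0 <= code_disagreement X.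
Proof. by apply: sumr_ge0 => j _; exact: disagreement_ge0. Qed.

Lemma code_disagreementE X :
  code_disagreement X = n%:R ^+ 2 * d%:R - \sum_j colsum (X j) ^+ 2.
Proof. by rewrite /code_disagreement sumrB sumr_const card_ord mulr_natr. Qed.

Lemma sum_code_score a X Y :
  \sum_i code_score a i X Y = 2 * a * \sum_j Y j * colsum (X j).
Proof.
rewrite exchange_big mulr_sumr; apply: eq_bigr => j _ /=.
by rewrite -mulr_sumr sum_score mulrCA.
Qed.

Lemma code_disagreement_mean_le a : 0 < a ->
  \sum_X code_mass a X * code_disagreement X
  <= 2 * a * n%:R ^+ 2 * d%:R * \sum_X code_mass a X.
Proof.
move=> a_gt0; rewrite [_ * d%:R]mulrC -[d in d%:R]card_ord.
apply: (@sum_prod_additive_le _ _ _ (fun _ w => polya a w) disagreement)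
  => [_ w|_].
  by rewrite ltW ?polya_gt0.
exact: disagreement_mean_le.
Qed.

Lemma coherent_mass a : 0 < a -> (0 < n)%N -> (0 < d)%N ->
  \sum_X code_mass a X <= 2 * \sum_(X | coherent a X) code_mass a X.
Proof.
move=> a_gt0 n_gt0 d_gt0; pose c : F := 2 * a * n%:R ^+ 2 * d%:R.
have c_gt0 : 0 < c by rewrite !mulr_gt0 ?exprn_gt0 ?ltr0n.
have coherentE X : coherent a X = (code_disagreement X <= 2 * c).
  by congr (_ <= _); rewrite /c; ring.
have mass_ge0 X : 0 <= code_mass a X by rewrite ltW ?code_mass_gt0.
have : 2 * c * \sum_(X | ~~ coherent a X) code_mass a X
    <= c * \sum_X code_mass a X.
  apply: le_trans (code_disagreement_mean_le a_gt0).
  under eq_bigl => X do rewrite coherentE.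
  exact: weighted_markov mass_ge0 code_disagreement_ge0.
rewrite (mulrC 2) -mulrA ler_pM2l //.
rewrite [\sum_X code_mass a X](bigID (coherent a)) /=; lra.
Qed.

Lemma coherent_score_var a i X Y :
    0 < a <= 1 -> (forall j, `|Y j| <= 1) -> coherent a X ->
  code_score_var a i X Y <= 8 * a * n%:R ^+ 2 * d%:R.
Proof.
move=> a01 Y_le1; rewrite /coherent => coh.
apply: (@le_trans _ _ (\sum_(j < d) (disagreement (X j) + 4 * a * n%:R ^+ 2))).
  apply: ler_sum => j _.
  apply: le_trans (score_var_le_disagreement i (X j) a01).
  apply: ler_piMl; first by apply: score_var_ge0; case/andP: a01 => /ltW.
  by rewrite -[leRHS](expr1n _ 2) ler_sqr_norm.
rewrite big_split sumr_const card_ord -mulr_natr -/(code_disagreement X) /=.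
lra.
Qed.

End Mass.

Section Tail.
Context {F : realType}.
Implicit Types (a t : F) (Y : 'I_d -> F).

Lemma code_score_mgf a t i X Y :
    0 < a -> (forall j, `|t * Y j| * (4 * urn_mass n a) <= 1) ->
  \sum_b code_mass a (setrow i b X) *
    expR (t * code_score a i (setrow i b X) Y -
      2 * t ^+ 2 * code_score_var a i (setrow i b X) Y)
  <= \sum_b code_mass a (setrow i b X).
Proof.
move=> a_gt0 t_small.
pose tilt (j : 'I_d) w :=
  expR (t * Y j * score a i w - 2 * (t * Y j) ^+ 2 * score_var a i w).
have -> : \sum_b code_mass a (setrow i b X)
    = \prod_j \sum_c polya a (upd i c (X j)).
  rewrite (bigA_distr_bigA (fun j c => polya a (upd i c (X j)))).
  by apply: eq_bigr => b _; apply: eq_bigr => j _; rewrite ffunE.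
rewrite (eq_bigr (fun b : bits d => \prod_j (polya a (upd i (b j) (X j)) *
    tilt j (upd i (b j) (X j))))).
  rewrite -(bigA_distr_bigA (fun j c =>
    polya a (upd i c (X j)) * tilt j (upd i c (X j)))).
  apply: ler_prod => j _; rewrite polya_score_mgf // andbT.
  by apply: sumr_ge0 => c _; rewrite mulr_ge0 ?expR_ge0 // ltW ?polya_gt0.
move=> b _; rewrite big_split /= -expR_sum; congr (_ * expR _).
  by apply: eq_bigr => j _; rewrite ffunE.
rewrite /code_score /code_score_var !mulr_sumr -sumrB.
by apply: eq_bigr => j _; rewrite ffunE exprMn !mulrA.
Qed.

Lemma code_score_tail a t v th i X Y :
    0 < a -> (forall j, `|Y j| <= 1) -> 0 <= th ->
    th * (4 * urn_mass n a) <= 1 ->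
  \sum_(b | (code_score_var a i (setrow i b X) Y <= v) &&
            (t <= `|code_score a i (setrow i b X) Y|))
     code_mass a (setrow i b X)
  <= 2 * expR (2 * th ^+ 2 * v - th * t) * \sum_b code_mass a (setrow i b X).
Proof.
move=> a_gt0 Y_le1 th_ge0 th_small.
have N_ge0 : 0 <= urn_mass n a.
  apply: le_trans (normr_ge0 _) _.
  exact: norm_colsum_off_le_urn_mass i [ffun=> true] (ltW a_gt0).
pose S b := code_score a i (setrow i b X) Y.
pose V b := 2 * th ^+ 2 * code_score_var a i (setrow i b X) Y.
apply: le_trans (weighted_chernoff_abs (S := S) (V := V) _ _ _ th_ge0 _)
  => [|b|s s_th].
- apply: ler_sum_subpred => [b|b /= /andP[var_le ->]].
    by rewrite ltW ?code_mass_gt0.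
  by rewrite andbT ler_wpM2l // mulr_ge0 ?sqr_ge0.
- by rewrite ltW ?code_mass_gt0.
rewrite /S /V -s_th real_normK ?num_real //; apply: code_score_mgf => // j.
apply: le_trans th_small; rewrite ler_wpM2r ?mulr_ge0 // normrM s_th.
by rewrite ler_piMr.
Qed.

(* The Chernoff exponent [2 th^2 v - th t] with [t = a d] and [v = 8 a n^2 d] is
   optimal at [th = 1 / (32 n^2)]. *)
Lemma coherent_score_tail a i X Y : 0 < a <= 1 -> (forall j, `|Y j| <= 1) ->
  \sum_(b | coherent a (setrow i b X) &&
            (a * d%:R <= `|code_score a i (setrow i b X) Y|))
     code_mass a (setrow i b X)
  <= 2 * expR (- (a * d%:R / (64 * n%:R ^+ 2))) *
     \sum_b code_mass a (setrow i b X).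
Proof.
move=> a01 Y_le1; have /andP[a_gt0 a_le1] := a01.
have n_ge1 : 1 <= n%:R :> F := ler1_ord_size F i.
have n_gt0 : 0 < n%:R :> F by exact: lt_le_trans n_ge1.
pose th : F := (32 * n%:R ^+ 2)^-1.
have th_gt0 : 0 < th by rewrite invr_gt0 mulr_gt0 ?exprn_gt0.
have th_small : th * (4 * urn_mass n a) <= 1.
  rewrite mulrC ler_pdivrMr ?mulr_gt0 ?exprn_gt0 // mul1r /urn_mass.
  have : n%:R <= n%:R ^+ 2 :> F by rewrite expr2 ler_peMl // ltW.
  lra.
have -> : - (a * d%:R / (64 * n%:R ^+ 2))
    = 2 * th ^+ 2 * (8 * a * n%:R ^+ 2 * d%:R) - th * (a * d%:R).
  by rewrite /th; field; rewrite gt_eqF.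
apply: le_trans (code_score_tail _ _ _ _ a_gt0 Y_le1 (ltW th_gt0) th_small).
apply: ler_sum_subpred => [b|b /= /andP[coh ->]].
  by rewrite ltW ?code_mass_gt0.
by rewrite andbT coherent_score_var.
Qed.

End Tail.
End Code.

Definition accurate (n d : nat) (X : 'M[R]_(n, d)) (v : 'rV[R]_d) (c : R) :
    set (vecB d) :=
  [set y | sqnormXy X v - c * n%:R <= sqnormXy X y]%classic.
Arguments accurate [n d] X v c%_ring_scope.

Section Mechanisms.
Context {n d : nat}.
Implicit Types (X Y : 'M[R]_(n, d)) (v y : 'rV[R]_d).

Lemma diff_private_row (Mg : 'M[R]_(n, d) -> probability (vecB d) R)
    (eps delta : R) X Y (i : 'I_n) (T : set (vecB d)) :
    0 <= eps -> 0 <= delta -> diff_private eps delta Mg ->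
    dataset X -> dataset Y ->
    (forall k, k != i -> row k X = row k Y) -> measurable T ->
  pr (Mg X) T <= expR eps * pr (Mg Y) T + delta.
Proof.
move=> eps_ge0 delta_ge0 dp dX dY XY mT.
have [rowXY|rowXY] := eqVneq (row i X) (row i Y).
  have -> : X = Y by apply/row_matrixP => k; have [->|/XY] := eqVneq k i.
  by rewrite ler_wpDr // ler_peMl ?pr_ge0 // -[leLHS]expR0 ler_expR.
rewrite -lee_fin EFinD EFinM !EFin_pr //; apply: dp => //.
by exists i; split=> // k /eqP; exact: XY.
Qed.

Lemma measurable_accurate X v c : measurable (accurate X v c).
Proof. by apply: measurable_ge_continuous; exact: continuous_sqnormXy. Qed.

Lemma estimator_accurate (lam beta g : R) (M : mechanism n d) X v :
    top_sv_estimator lam beta M -> dataset X -> 0 <= g <= 1 ->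
    singular_value X 2 <= g * singular_value X 1 -> top_right_sv X v ->
  beta <= pr (M g X) (accurate X v (lam * g)).
Proof.
move=> est dX g01 ratio tv.
rewrite -lee_fin EFin_pr; last exact: measurable_accurate.
have := est X g v dX g01 ratio tv; congr (_ <= M g X _)%E.
(* [top_sv_estimator] states the inequality with [Rle], [Rminus] and [Rmult]. *)
by apply/seteqP; split=> y; rewrite /accurate /= RminusE !RmultE => /RleP.
Qed.

End Mechanisms.

Section CodeMatrix.
Context {n d : nat}.
Hypothesis d_gt0 : (0 < d)%N.
Implicit Types (i : 'I_n) (X : code n d) (y v : 'rV[R]_d) (a g : R).

Definition code_mx X : 'M[R]_(n, d) :=
  \matrix_(i, j) (spin (X j i) / Num.sqrt d%:R).

Lemma dimR_gt0 : 0 < d%:R :> R.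
Proof. by rewrite ltr0n. Qed.

Lemma sqr_sqrt_dim : Num.sqrt d%:R ^+ 2 = d%:R :> R.
Proof. by rewrite sqr_sqrtr. Qed.

Lemma sqrt_dim_neq0 : Num.sqrt d%:R != 0 :> R.
Proof. by rewrite sqrtr_eq0 -ltNge dimR_gt0. Qed.

Lemma dataset_code_mx X : dataset (code_mx X).
Proof.
move=> i; rewrite /sphere /= /sqnorm (eq_bigr (fun=> d%:R^-1)) => [|j _].
  by rewrite sumr_const card_ord -[_ *+ d]mulr_natr mulVf // gt_eqF // dimR_gt0.
by rewrite !mxE exprMn sqr_spin exprVn sqr_sqrt_dim mul1r.
Qed.

Lemma rowsum_code_mx X j :
  rowsum (code_mx X) ord0 j = colsum (X j) / Num.sqrt d%:R.
Proof.
rewrite summxE /colsum mulr_suml.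
by apply: eq_bigr => i _; rewrite !mxE.
Qed.

Lemma sqnorm_rowsum_code_mx X :
  sqnorm (rowsum (code_mx X)) = n%:R ^+ 2 - code_disagreement X / d%:R.
Proof.
rewrite code_disagreementE mulrBl mulfK ?gt_eqF ?dimR_gt0 // subKr mulr_suml.
by apply: eq_bigr => j _; rewrite rowsum_code_mx exprMn exprVn sqr_sqrt_dim.
Qed.

Lemma coherent_rowsum a X :
  coherent a X -> (1 - 4 * a) * n%:R ^+ 2 <= sqnorm (rowsum (code_mx X)).
Proof.
rewrite /coherent -ler_pdivrMr ?dimR_gt0 // sqnorm_rowsum_code_mx; lra.
Qed.

Lemma coherent_singular_ratio a g X :
    (0 < n)%N -> 0 <= g -> 4 * a <= g ^+ 2 * (1 - 4 * a) -> coherent a X ->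
  singular_value (code_mx X) 2 <= g * singular_value (code_mx X) 1.
Proof.
move=> n_gt0 g_ge0 a_g_le coh.
have [v tv] := top_right_sv_exists (code_mx X) d_gt0.
apply: (singular_value_ratio (dataset_code_mx X) tv) => //.
have n_pos : 0 < n%:R :> R by rewrite ltr0n.
have top_ge : (1 - 4 * a) * n%:R <= sqnormXy (code_mx X) v.
  rewrite -(ler_pM2l n_pos) mulrCA -expr2.
  exact: le_trans (coherent_rowsum coh) (sqnorm_rowsum_le tv).
have := ler_wpM2l (sqr_ge0 g) top_ge; have := ler_wpM2r (ltW n_pos) a_g_le; lra.
Qed.

(* An accurate [y] may still put a constant part of its mass on the few
   non-constant columns, and would then have unbounded scores there. *)
Definition clipv y (j : 'I_d) : R := clip (Num.sqrt d%:R * y ord0 j).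

Definition traced a i X : set (vecB d) :=
  [set y | a * d%:R <= `|code_score a i X (clipv y)|]%classic.

Lemma measurable_traced a i X : measurable (traced a i X).
Proof.
apply: (@measurable_ge_continuous _ (fun y => `|code_score a i X (clipv y)|)).
move=> y; apply: (@continuous_comp _ _ _ (fun y => code_score a i X (clipv y)));
  last exact: norm_continuous.
move: y; apply: continuous_sum => j y.
apply: (@continuousM _ _ (fun y => clipv y j)); last exact: cst_continuous.
apply: (@continuous_comp _ _ _ (fun y : 'rV[R]_d => Num.sqrt d%:R * y ord0 j));
  last exact: continuous_clip.
apply: (@continuousM _ _ (fun=> Num.sqrt d%:R)); first exact: cst_continuous.
exact: coord_continuous.
Qed.

Lemma clipped_correlation X y (c : R) :
    sphere d y -> c * n%:R <= `|dot (rowsum (code_mx X)) y| ->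
  (c - 1 / 4) * n%:R * d%:R <= `|\sum_j clipv y j * colsum (X j)|.
Proof.
move=> y_unit; pose z j := Num.sqrt d%:R * y ord0 j.
have -> : dot (rowsum (code_mx X)) y = (\sum_j z j * colsum (X j)) / d%:R.
  rewrite dotE mulr_suml; apply: eq_bigr => j _; rewrite rowsum_code_mx /z.
  by rewrite -[X in _ = _ / X]sqr_sqrt_dim; field; exact: sqrt_dim_neq0.
rewrite normrM normfV (gtr0_norm dimR_gt0) ler_pdivlMr ?dimR_gt0 // => corr.
have z_sqr : \sum_j z j ^+ 2 = d%:R.
  under eq_bigr do rewrite exprMn sqr_sqrt_dim.
  by rewrite -mulr_sumr -/(sqnorm y) y_unit mulr1.
have := dist_sum_clip_le z (fun j => norm_colsum_le (X j)); rewrite z_sqr.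
have := lerB_dist (\sum_j z j * colsum (X j))
  (\sum_j clip (z j) * colsum (X j)).
rewrite /clipv; lra.
Qed.

Lemma correlated_traced a X y :
    (0 < n)%N -> 0 <= a ->
    n%:R * d%:R / 2 <= `|\sum_j clipv y j * colsum (X j)| ->
  exists i, traced a i X y.
Proof.
move=> n_gt0 a_ge0 corr; apply: exists_norm_ge_mean; rewrite card_ord //.
rewrite sum_code_score normrM (ger0_norm (mulr_ge0 _ a_ge0)) //.
by have := ler_wpM2l a_ge0 corr; lra.
Qed.

Lemma accurate_traced a X v y :
    (0 < n)%N -> 0 <= a <= 1 / 64 -> coherent a X ->
    top_right_sv (code_mx X) v -> sphere d y ->
    accurate (code_mx X) v (1 / 4) y ->
  exists i, traced a i X y.
Proof.
move=> n_gt0 /andP[a_ge0 a_le] coh tv y_unit acc.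
apply: correlated_traced => //.
have dot_ge := dot_rowsum_sqr_ge n_gt0 (dataset_code_mx X) tv y_unit
  (coherent_rowsum coh) acc.
have an_le : a * n%:R ^+ 2 <= 1 / 64 * n%:R ^+ 2 by rewrite ler_wpM2r ?sqr_ge0.
have corr : 3 / 4 * n%:R <= `|dot (rowsum (code_mx X)) y|.
  rewrite -ler_sqr ?nnegrE ?mulr_ge0 // real_normK ?num_real //.
  by apply: le_trans dot_ge; have := sqr_ge0 (n%:R : R); lra.
by have := clipped_correlation y_unit corr; lra.
Qed.

Lemma estimator_traced (lam beta g a : R) (M : mechanism n d) X :
    (0 < n)%N -> 0 <= g <= 1 -> lam * g = 1 / 4 ->
    0 <= a <= 1 / 64 -> 4 * a <= g ^+ 2 * (1 - 4 * a) ->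
    outputs_on_sphere M -> top_sv_estimator lam beta M -> coherent a X ->
  beta <= \sum_i pr (M g (code_mx X)) (traced a i X).
Proof.
move=> n_gt0 g01 lam_g a_small a_g_le onS est coh; have dX := dataset_code_mx X.
have [v tv] := top_right_sv_exists (code_mx X) d_gt0.
have ratio : singular_value (code_mx X) 2 <= g * singular_value (code_mx X) 1.
  by apply: coherent_singular_ratio a_g_le coh => //; case/andP: g01.
apply: le_trans (estimator_accurate est dX g01 ratio tv) _; rewrite lam_g.
apply: (union_bound (S := sphere d : set (vecB d))).
- exact: measurable_accurate.
- by apply: measurable_closed; exact: closed_sphere.
- by move=> i; exact: measurable_traced.
- exact: onS.
- by move=> y acc y_unit; exact: accurate_traced acc.
Qed.

End CodeMatrix.

Section Tracing.
Context {n d : nat}.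
Hypothesis d_gt0 : (0 < d)%N.
Implicit Types (i : 'I_n) (X : code n d) (a : R).
Implicit Type Mg : 'M[R]_(n, d) -> probability (vecB d) R.

Definition blank i X : code n d := setrow i [ffun=> true] X.

Definition false_trace_pr Mg a i X : R :=
  pr (Mg (code_mx (blank i X))) (traced a i X).

Lemma private_traced Mg (eps delta : R) a i X :
    0 <= eps -> 0 <= delta -> diff_private eps delta Mg ->
  pr (Mg (code_mx X)) (traced a i X)
  <= expR eps * false_trace_pr Mg a i X + delta.
Proof.
move=> eps_ge0 delta_ge0 dp; apply: (@diff_private_row _ _ _ _ _ _ _ i) => //.
- exact: dataset_code_mx.
- exact: dataset_code_mx.
- by move=> k ki; apply/rowP => j; rewrite !mxE ffunE upd_neq.
- exact: measurable_traced.
Qed.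

(* The output on [blank i X] does not depend on row [i] of [X], so averaging
   over that row first leaves a tail of the score of a fixed vector. *)
Lemma false_trace_mean Mg a i : 0 < a <= 1 ->
  \sum_(X | coherent a X) code_mass a X * false_trace_pr Mg a i X
  <= 2 * expR (- (a * d%:R / (64 * n%:R ^+ 2))) *
     \sum_(X : code n d) code_mass a X.
Proof.
move=> a01; have /andP[a_gt0 _] := a01; set K := 2 * _.
have pow_gt0 : 0 < (2 ^ d)%:R :> R by rewrite ltr0n expn_gt0.
rewrite big_mkcond -(ler_pM2r pow_gt0) -mulrA !mulr_natr -!(sum_setrow i).
rewrite mulr_sumr; apply: ler_sum => X _ /=.
pose w (b : bits d) :=
  if coherent a (setrow i b X) then code_mass a (setrow i b X) else 0.
rewrite (eq_bigr (fun b => w b *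
    pr (Mg (code_mx (blank i X))) (traced a i (setrow i b X)))); last first.
  move=> b _; rewrite /w /false_trace_pr /blank setrow_setrow.
  by case: ifP => // _; rewrite mul0r.
apply: sum_pr_le => [b|b|y].
- exact: measurable_traced.
- by rewrite /w; case: ifP => // _; rewrite ltW ?code_mass_gt0.
have clipv_le1 j : `|clipv y j| <= 1 by exact: norm_clip_le1.
apply: le_trans (coherent_score_tail i X a01 clipv_le1).
rewrite [leRHS]big_mkcond; apply: ler_sum => b _; rewrite /w indicE.
have -> : (y \in traced a i (setrow i b X)) =
    (a * d%:R <= `|code_score a i (setrow i b X) (clipv y)|).
  by apply/idP/idP => [/set_mem|/mem_set].
by case: ifP => _; rewrite ?mul0r //=; case: ifP; rewrite ?mulr1 ?mulr0.
Qed.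

Lemma fingerprinting_bound (lam beta g a eps delta : R) (M : mechanism n d) :
    (0 < n)%N -> 0 <= g <= 1 -> lam * g = 1 / 4 ->
    0 < a <= 1 / 64 -> 4 * a <= g ^+ 2 * (1 - 4 * a) ->
    0 <= eps -> 0 <= delta ->
    outputs_on_sphere M -> top_sv_estimator lam beta M ->
    diff_private eps delta (M g) ->
  beta - n%:R * delta
  <= 4 * expR eps * n%:R * expR (- (a * d%:R / (64 * n%:R ^+ 2))).
Proof.
move=> n_gt0 g01 lam_g /andP[a_gt0 a_le] a_g_le eps_ge0 delta_ge0 onS est dp.
have a01 : 0 < a <= 1 by apply/andP; split=> //; lra.
have a_small : 0 <= a <= 1 / 64 by rewrite ltW.
set K := expR (- _); pose Z := \sum_(X : code n d) code_mass a X.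
pose Zc := \sum_(X : code n d | coherent a X) code_mass a X.
have Z_gt0 : 0 < Z.
  rewrite /Z (bigD1 [ffun=> [ffun=> true]]) //= ltr_wpDr ?code_mass_gt0 //.
  by apply: sumr_ge0 => X _; rewrite ltW ?code_mass_gt0.
have Z_le : Z <= 2 * Zc := coherent_mass a_gt0 n_gt0 d_gt0.
have trace X : coherent a X ->
    beta - n%:R * delta <= expR eps * \sum_i false_trace_pr (M g) a i X.
  move=> coh; rewrite lerBlDr.
  apply: le_trans
    (estimator_traced d_gt0 n_gt0 g01 lam_g a_small a_g_le onS est coh) _.
  rewrite -[n in n%:R * _]card_ord mulr_natl -sumr_const mulr_sumr.
  rewrite -big_split /=.
  by apply: ler_sum => i _; exact: private_traced.
have lower : (beta - n%:R * delta) * Zc <= expR eps *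
    \sum_i \sum_(X : code n d | coherent a X)
      code_mass a X * false_trace_pr (M g) a i X.
  rewrite exchange_big !mulr_sumr; apply: ler_sum => X coh /=.
  by rewrite -mulr_sumr mulrCA mulrC ler_wpM2l ?trace // ltW ?code_mass_gt0.
have upper : \sum_i \sum_(X : code n d | coherent a X)
    code_mass a X * false_trace_pr (M g) a i X <= n%:R * (2 * K * Z).
  rewrite -[n in n%:R]card_ord mulr_natl -sumr_const.
  by apply: ler_sum => i _; exact: false_trace_mean.
have Zc_gt0 : 0 < Zc by lra.
rewrite -(ler_pM2r Zc_gt0); apply: le_trans lower _.
apply: le_trans (ler_wpM2l (expR_ge0 eps) upper) _.
have -> : 4 * expR eps * n%:R * K * Zc
    = expR eps * (n%:R * (2 * K * (2 * Zc))) by ring.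
by rewrite !ler_wpM2l ?mulr_ge0 ?expR_ge0.
Qed.

End Tracing.

Section SampleSize.
Variable F : realType.
Implicit Types D N lam beta L x : F.

Lemma expR_half_le2 : expR (1 / 2) <= 2 :> F.
Proof. by have := expR_le_quadratic (lexx (1 / 2 : F)); rewrite expr2; lra. Qed.

Lemma expR1_le4 : expR 1 <= 4 :> F.
Proof.
have <- : expR (1 / 2) * expR (1 / 2) = expR 1 :> F.
  by rewrite -expRD; congr expR; field.
have := ler_pM (expR_ge0 _) (expR_ge0 _) expR_half_le2 expR_half_le2; lra.
Qed.

Lemma ln_ge_half x : 2 <= x -> 1 / 2 <= ln x.
Proof.
move=> x_ge2; have x_gt0 : 0 < x by lra.
by rewrite -ler_expR lnK ?posrE // (le_trans expR_half_le2).
Qed.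

Lemma exp_tail_lt N beta x u :
    0 < beta -> 0 < N <= beta * x -> 2 <= x -> 6 * ln x <= u ->
  4 * expR 1 * N * expR (- u) < 3 / 4 * beta.
Proof.
move=> beta_gt0 /andP[N_gt0 N_le] x_ge2 u_ge.
have x_gt0 : 0 < x by lra.
have tail_le : expR (- u) * x ^+ 6 <= 1.
  rewrite -[x in x ^+ 6]lnK ?posrE // -expRM_natl -expRD -[leRHS]expR0.
  by rewrite ler_expR; lra.
have x5_ge : 32 <= x ^+ 5.
  have -> : 32 = 2 ^+ 5 :> F by ring.
  by rewrite ler_pXn2r // nnegrE ltW.
rewrite -(ltr_pM2r (exprn_gt0 6 x_gt0)) -[ltLHS]mulrA.
have N_ge0 : 0 <= 4 * expR 1 * N by rewrite !mulr_ge0 ?expR_ge0 // ltW.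
apply: le_lt_trans (ler_piMr N_ge0 tail_le) _.
apply: (@le_lt_trans _ _ (16 * (beta * x))).
  by have := ler_wpM2r (ltW N_gt0) expR1_le4; lra.
rewrite [x ^+ 6]exprS; have bx_gt0 : 0 < beta * x by rewrite mulr_gt0.
have := ler_wpM2l (ltW bx_gt0) x5_ge; lra.
Qed.

Lemma dim_le_of_exp_bound D N lam beta :
    0 < N -> 1 <= D -> 1 <= lam -> 0 < beta -> 2 <= D / (beta * lam) ->
    3 / 4 * beta
      <= 4 * expR 1 * N * expR (- (D / (2 ^+ 14 * (lam * N) ^+ 2))) ->
  D <= 2 ^+ 17 * (lam * N) ^+ 2 * ln (D / (beta * lam)).
Proof.
move=> N_gt0 D_ge1 lam_ge1 beta_gt0; set x := D / _ => x_ge2.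
apply: contraTT; rewrite -!ltNge => D_gt.
have L_ge := ln_ge_half x_ge2.
have lam_gt0 : 0 < lam by lra.
have D_gt0 : 0 < D by lra.
have lamN_gt0 : 0 < lam * N by rewrite mulr_gt0.
have lamN2_ge0 := sqr_ge0 (lam * N).
have lamN2_L_ge := ler_wpM2l lamN2_ge0 L_ge.
have lamN_le : lam * N <= D.
  rewrite -ler_sqr ?nnegrE ?ltW //.
  have : D <= D ^+ 2 by rewrite expr2 ler_peMl // ltW.
  lra.
apply: (exp_tail_lt beta_gt0 _ x_ge2).
  rewrite N_gt0; have -> : beta * x = D / lam.
    by rewrite /x; field; rewrite !gt_eqF.
  by rewrite ler_pdivlMr // mulrC.
by rewrite ler_pdivlMr ?mulr_gt0 ?exprn_gt0 //; lra.
Qed.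

Lemma sqrt_div_powR_le D N lam L :
    0 < N -> 0 < lam -> 1 / 2 <= L -> D <= 2 ^+ 17 * (lam * N) ^+ 2 * L ->
  1 / 2 ^+ 10 * ((Num.sqrt D / lam) / L `^ (3 / 2)) <= N.
Proof.
move=> N_gt0 lam_gt0 L_ge D_le; set p := L `^ (3 / 2).
have p_gt0 : 0 < p by apply: powR_gt0; lra.
have p_sqr : p ^+ 2 = L ^+ 3.
  rewrite /p -powR_mulrn ?powR_ge0 // -powRrM -powR_mulrn; last by lra.
  by congr (_ `^ _); lra.
have -> : 1 / 2 ^+ 10 * ((Num.sqrt D / lam) / p)
    = Num.sqrt D / (2 ^+ 10 * lam * p).
  by field; rewrite !gt_eqF.
rewrite ler_pdivrMr ?mulr_gt0 ?exprn_gt0 //.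
have bound_ge0 : 0 <= N * (2 ^+ 10 * lam * p).
  by rewrite !mulr_ge0 ?exprn_ge0 // ltW.
rewrite -[leRHS]ger0_norm // -sqrtr_sqr ler_wsqrtr // (le_trans D_le) //.
have L_sqr : 1 / 4 <= L ^+ 2 by rewrite expr2; nra.
have -> : (N * (2 ^+ 10 * lam * p)) ^+ 2
    = 2 ^+ 20 * (lam * N) ^+ 2 * p ^+ 2 by ring.
have L_gt0 : 0 < L by lra.
have lamN2_L_ge0 : 0 <= (lam * N) ^+ 2 * L by rewrite mulr_ge0 ?sqr_ge0 ?ltW.
rewrite p_sqr exprS; have := ler_wpM2l lamN2_L_ge0 L_sqr; lra.
Qed.

End SampleSize.

(* The choice [g = 1 / (4 lam)] makes the allowed loss [lam g n] equal to
   [n / 4], and [a = g^2 / 16] keeps the coherent matrices within the ratio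
   [g]. *)
Lemma private_estimator_exp_bound (n d : nat) (lam beta : R)
    (M : mechanism n d) :
    (0 < n)%N -> (0 < d)%N -> 1 <= lam -> 0 < beta ->
    outputs_on_sphere M -> top_sv_estimator lam beta M ->
    (forall g : R, 0 <= g <= 1 -> diff_private 1 (beta / (4 * n%:R)) (M g)) ->
  3 / 4 * beta
  <= 4 * expR 1 * n%:R * expR (- (d%:R / (2 ^+ 14 * (lam * n%:R) ^+ 2))).
Proof.
move=> n_gt0 d_gt0 lam_ge1 beta_gt0 onS est dp.
have n_pos : 0 < n%:R :> R by rewrite ltr0n.
have lam_gt0 : 0 < lam by lra.
pose g := (4 * lam)^-1; pose a := g ^+ 2 / 16.
have g_gt0 : 0 < g by rewrite invr_gt0 mulr_gt0.
have lam_g : lam * g = 1 / 4 by rewrite /g; field; rewrite gt_eqF.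
have g_le : g <= 1 / 4 by have := ler_wpM2r (ltW g_gt0) lam_ge1; lra.
have g2_gt0 : 0 < g ^+ 2 by rewrite exprn_gt0.
have g2_le : g ^+ 2 <= 1 / 16.
  by have := ler_pM (ltW g_gt0) (ltW g_gt0) g_le g_le; rewrite -expr2; lra.
have g01 : 0 <= g <= 1 by apply/andP; split; lra.
have a_bounds : 0 < a <= 1 / 64 by apply/andP; rewrite /a; split; lra.
have a_g_le : 4 * a <= g ^+ 2 * (1 - 4 * a).
  by have := ler_wpM2l (ltW g2_gt0) g2_le; rewrite /a; lra.
have delta_ge0 : 0 <= beta / (4 * n%:R) by rewrite divr_ge0 ?mulr_ge0 // ltW.
have := fingerprinting_bound d_gt0 n_gt0 g01 lam_g a_bounds a_g_le ler01
  delta_ge0 onS est (dp g g01).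
have -> : beta - n%:R * (beta / (4 * n%:R)) = 3 / 4 * beta.
  by field; rewrite gt_eqF.
have -> // : a * d%:R / (64 * n%:R ^+ 2)
    = d%:R / (2 ^+ 14 * (lam * n%:R) ^+ 2).
by rewrite /a /g; field; rewrite !gt_eqF.
Qed.

Theorem theorem1p18 :
  exists c : R, 0 < c /\
  forall (n d : nat) (lam beta : R) (M : mechanism n d),
    leq 1 n -> 1 <= lam -> 0 < beta <= 1 ->
    2 <= d%:R / (beta * lam) ->
    outputs_on_sphere M ->
    top_sv_estimator lam beta M ->
    (forall g : R, 0 <= g <= 1 -> diff_private 1 (beta / (4 * n%:R)) (M g)) ->
    c * ((Num.sqrt d%:R / lam) / (ln (d%:R / (beta * lam)) `^ (3 / 2))) <= n%:R.
Proof.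
exists (1 / 2 ^+ 10); split; first by rewrite divr_gt0 ?exprn_gt0.
move=> n d lam beta M n_gt0 lam_ge1 /andP[beta_gt0 _] x_ge2 onS est dp.
have d_gt0 : (0 < d)%N.
  by move: x_ge2; case: d {M onS est dp} => //; rewrite mul0r leNgt ltr0n.
have n_pos : 0 < n%:R :> R by rewrite ltr0n.
apply: sqrt_div_powR_le => //; first exact: lt_le_trans lam_ge1.
  exact: ln_ge_half.
apply: dim_le_of_exp_bound => //; first by rewrite ler1n.
exact: private_estimator_exp_bound onS est dp.
Qed.
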